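(* There exist absolute constants $\beta\in(0,1)$ and $c>0$ such that the following holds. Let $\eta>0$, $M=\max(m_1,m_2)$, and let $r$ be an integer with $1\le r\le\min(m_1,m_2)$ and $Mr\le n$. Let $(X_i,Y_i)$, $i=1,\dots,n$, be i.i.d. realizations of a random pair $(X,Y)$ with distribution $P_{XY}$. Then $$\inf_{\hat A}\ \sup_{\mathrm{rank}(A_0)\le r}\ \sup_{P_{XY}\in\mathcal P_{A_0,\eta}}\mathbb P\left(\frac1{m_1m_2}\|\hat A-A_0\|_2^2>c\,\eta^2\,\frac{Mr}{n}\right)\ge\beta .$$
   Context: $\mathcal X=\{e_j(m_1)e_k(m_2)^\top:1\le j\le m_1,\,1\le k\le m_2\}$, where $e_k(d)$ are the canonical basis vectors of $\mathbb R^d$, and $\Pi_0$ is the uniform distribution on $\mathcal X$. For $A_0\in\mathbb R^{m_1\times m_2}$, $$\mathcal P_{A_0,\eta}=\{P_{XY}:\ X\sim\Pi_0,\ |Y|\le\eta\ \text{(a.s.)},\ \mathbb E(Y\mid X)=\langle A_0,X\rangle\},\qquad\langle A,B\rangle=\mathrm{tr}(A^\top B).$$ The supremum over $A_0$ is over matrices in $\mathbb R^{m_1\times m_2}$ of rank at most $r$. $\|\cdot\|_2$ is the Frobenius norm. $\inf_{\hat A}$ is the infimum over all estimators, i.e. measurable functions of $(X_1,Y_1,\dots,X_n,Y_n)$ with values in $\mathbb R^{m_1\times m_2}$; $\mathbb P$ is the law of the sample. *)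

(* Defs.v *)
From HB Require Import structures.
From mathcomp Require Import all_boot all_order all_algebra.
From mathcomp Require Import finmap.
From mathcomp Require Import all_classical all_reals all_analysis.

Set Implicit Arguments.
Unset Strict Implicit.
Unset Printing Implicit Defensive.

Import Order.TTheory GRing.Theory Num.Theory.
Import numFieldNormedType.Exports.

Local Open Scope classical_set_scope.
Local Open Scope ring_scope.

(* Real matrices carry the Borel sigma-algebra of their usual topology. *)
Section matrix_borel.
Context (R : realType) (m n : nat).

Local Notation borel := (@open 'M[R]_(m, n)).

HB.instance Definition _ :=
  @isMeasurable.Build (sigma_display borel) 'M[R]_(m, n) <<s borel >>
    (@sigma_algebra0 _ setT borel) (@sigma_algebraC _ borel)
    (@sigma_algebra_bigcup _ setT borel).

End matrix_borel.

Section sample_law.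
Context d (T : measurableType d) (R : realType).

Definition tcons n (x : T * n.-tuple T) : n.+1.-tuple T :=
  [the n.+1.-tuple T of x.1 :: x.2].

Lemma measurable_tcons n : measurable_fun setT (@tcons n).
Proof. exact: measurable_cons measurable_fst measurable_snd. Qed.

HB.instance Definition _ n :=
  isMeasurableFun.Build _ _ _ _ (@tcons n) (@measurable_tcons n).

(* The n-fold product of P, i.e. the law of n i.i.d. draws from P. *)
Fixpoint sample_law (P : probability T R) (n : nat) :
    probability (n.-tuple T) R :=
  match n with
  | 0 => \d_[tuple]
  | k.+1 => distribution (P \x sample_law P k)%E (@tcons k)
  end.

Lemma sample_lawE (P : probability T R) n (B : 'I_n -> set T) :
  (forall i, measurable (B i)) ->
  sample_law P n [set t | forall i, B i (tnth t i)] =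
  (\prod_(i < n) P (B i))%E.
Proof.
elim: n B => [|n IH] B mB /=.
  by rewrite big_ord0 diracE mem_set // => -[].
rewrite big_ord_recl /distribution /pushforward /=.
have mB' : measurable [set t : n.-tuple T | forall i, B (lift ord0 i) (tnth t i)].
  rewrite (_ : [set _ | _] =
      \bigcap_(i in [set: 'I_n]) ((@tnth _ T ^~ i) @^-1` B (lift ord0 i))); last first.
    by apply/seteqP; split=> t /= H i; [move=> _; exact: H|exact: (H i I)].
  apply: fin_bigcap_measurable => // i _.
  by rewrite -[X in measurable X]setTI; exact: measurable_tnth.
rewrite -IH // -product_measure1E //; congr (_ _).
apply/seteqP; split=> -[x t] /=.
  move=> H; split; first by have := H ord0; rewrite tnth0.
  by move=> i; have := H (lift ord0 i); rewrite tnthS.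
move=> [Hx Ht] i; case: (unliftP ord0 i) => [j|] ->.
  by rewrite tnthS; exact: Ht.
by rewrite tnth0.
Qed.

End sample_law.

(* The random variable g(X) is a version of E(Y | X) under P. *)
Definition is_cond_exp d d' (T : measurableType d) (T' : measurableType d')
    (R : realType) (P : probability T R) (Y : T -> R) (X : T -> T')
    (g : T' -> R) : Prop :=
  [/\ P.-integrable setT (EFin \o Y),
      measurable_fun setT g,
      P.-integrable setT (EFin \o (g \o X)) &
      forall B : set T', measurable B ->
        (\int[P]_(w in X @^-1` B) (Y w)%:E =
         \int[P]_(w in X @^-1` B) (g (X w))%:E)%E].

(* For finite S only: fset_set sends an infinite set to the empty one. *)
Definition uniform_on (R : realType) (T : choiceType) (S B : set T) : R :=
  #|` fset_set (S `&` B)|%:R / #|` fset_set S|%:R.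

Section trace_regression.
Context (R : realType) (m1 m2 : nat).
Implicit Types A B : 'M[R]_(m1, m2).

Definition mxdot A B : R := \tr (A^T *m B).

Definition frobenius A : R := Num.sqrt (mxdot A A).

Definition evec d (k : 'I_d) : 'cV[R]_d := delta_mx k 0.

Definition designs : set 'M[R]_(m1, m2) :=
  [set X | exists j k, X = evec j *m (evec k)^T].

(* The joint laws of a pair (X, Y), where X and Y are the two coordinates. *)
Definition mx_class (A0 : 'M[R]_(m1, m2)) (eta : R) :
    set (probability ('M[R]_(m1, m2) * R)%type R) :=
  [set P : probability ('M[R]_(m1, m2) * R)%type R |
    [/\ forall B : set 'M[R]_(m1, m2), measurable B ->
          P (fst @^-1` B) = (uniform_on R designs B)%:E,
        {ae P, forall z : 'M[R]_(m1, m2) * R, `|z.2| <= eta} &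
        is_cond_exp P snd fst (mxdot A0)]].

(* An estimator maps the sample (X_1, Y_1), ..., (X_n, Y_n) to a matrix. *)
Definition estimators (n : nat) :
    set (n.-tuple ('M[R]_(m1, m2) * R)%type -> 'M[R]_(m1, m2)) :=
  [set Ahat | measurable_fun setT Ahat].

End trace_regression.

(* Main.v *)
(* Assouad's hypercube. The m1 m2 cells are labelled by M r bits so that every
   label is carried by at most 2 m1 m2 / (M r) cells and the labelling is
   periodic modulo r along the shorter side, so that the matrix
   A_e whose entries are eta delta (e = 1) or - eta delta (e = 0) has rank at
   most r for every bit vector e. Let Y = eta or - eta with conditional mean
   A_e(X), where delta^2 = M r / (16 n). Flipping one bit only affects the law
   of Y on the cells of that label, so the affinity of the two n-sample laws is
   at least (1 - 2 delta^2 / (M r))^n >= 3/4, and the sign of the estimator at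
   a given cell is wrong with average probability at least 1/8. As the fraction
   of wrong signs is at most 1, for some e it exceeds 1/16 with probability at
   least 1/16, and each wrong sign costs (eta delta)^2. All the laws are
   finitely supported, so the sample law is bounded below by a finite sum. *)

Require Import Defs.
From HB Require Import structures.
From mathcomp Require Import all_boot all_order all_algebra.
From mathcomp Require Import finmap.
From mathcomp Require Import all_classical all_reals all_analysis.
From mathcomp Require Import measurable_realfun ring lra.

Set Implicit Arguments.
Unset Strict Implicit.
Unset Printing Implicit Defensive.

Import Order.TTheory GRing.Theory Num.Theory.
Import numFieldNormedType.Exports.

Local Open Scope classical_set_scope.
Local Open Scope ring_scope.

(** * Elementary inequalities *)

Lemma bernoulli_ineq (R : realFieldType) (x : R) n :
  0 <= x <= 1 -> 1 - n%:R * x <= (1 - x) ^+ n.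
Proof.
move=> /andP[x0 x1]; elim: n => [|n IH]; first by rewrite mul0r subr0 expr0.
rewrite exprS; apply: (@le_trans _ _ ((1 - x) * (1 - n%:R * x))); last first.
  by apply: ler_wpM2l => //; lra.
rewrite -natr1; have : 0 <= n%:R * (x * x) :> R by rewrite !mulr_ge0.
by lra.
Qed.

(* AM-GM: [sqrt (p q) <= min p q + max p q / 4]. *)
Lemma le_minD_max4 (R : realFieldType) (s p q : R) :
  0 <= p -> 0 <= q -> s ^+ 2 <= p * q -> s - (p + q) / 4 <= Num.min p q.
Proof.
wlog pq : p q / p <= q => [hw p0 q0 h|p0 q0 h].
  have [pq|qp] := orP (le_total p q).
    exact: hw.
  by rewrite minC (addrC p); apply: hw; rewrite // mulrC.
rewrite min_l // lerBlDr; have [s0|s0] := leP s 0; first by lra.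
rewrite -(@ler_pXn2r _ 2) ?nnegrE //; [|lra|lra].
(* The identity behind the bound is [(p + q / 4) ^+ 2 - p * q = (p - q / 4) ^+ 2]. *)
apply: (le_trans h); have := sqr_ge0 (p - q / 4); rewrite !expr2.
by nra.
Qed.

(** The indices with [f i <= a] contribute at most [a] to the mean. Each other index contributes at
    most [p i], because [f] is bounded by 1. *)
Lemma reverse_markov (R : realFieldType) (I : finType) (p f : I -> R) (a : R) :
  (forall i, 0 <= p i) -> \sum_i p i = 1 -> 0 <= a -> (forall i, f i <= 1) ->
  \sum_i p i * f i - a <= \sum_(i | a < f i) p i.
Proof.
move=> p0 p1 a0 f1.
have aE : a = \sum_i a * p i by rewrite -mulr_sumr p1 mulr1.
rewrite lerBlDr {2}aE [X in _ <= X + _]big_mkcond -big_split /=.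
apply: ler_sum => i _; case: ltP => h.
  by rewrite ler_wpDr ?mulr_ge0 ?ler_piMr.
by rewrite add0r mulrC ler_wpM2r.
Qed.

(** * Assouad's argument over a finite sample space *)

Section assouad.
Variables (R : realFieldType) (C J : finType) (lab : C -> J) (delta : R).
Hypotheses (delta_ge0 : 0 <= delta) (delta_le1 : delta <= 1).
Hypothesis C_gt0 : (0 < #|C|)%N.
Implicit Types (e : {ffun J -> bool}) (z : C * bool) (b : J).

Definition signb (y : bool) : R := if y then 1 else -1.

(** The cell is uniform, and the sign agrees with the bit of its label with probability
    [(1 + delta) / 2]. The conditional mean of the sign is therefore [delta] times the signed
    bit. *)
Definition cell_pmf e z : R :=
  (1 + delta * signb (z.2 == e (lab z.1))) / (2 * #|C|%:R).

Let CR_gt0 : 0 < #|C|%:R :> R. Proof. by rewrite ltr0n. Qed.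

Lemma cell_pmf_ge0 e z : 0 <= cell_pmf e z.
Proof.
rewrite /cell_pmf divr_ge0 ?mulr_ge0 ?ler0n // /signb.
by move: delta_ge0 delta_le1; case: ifP => _; lra.
Qed.

Lemma sum_cell_pmf e : \sum_z cell_pmf e z = 1.
Proof.
transitivity (\sum_(c : C) (#|C|%:R^-1 : R)); last first.
  by rewrite sumr_const -[_^-1 *+ _]mulr_natl mulfV // gt_eqF.
transitivity (\sum_c \sum_y cell_pmf e (c, y)).
  by rewrite pair_bigA; apply: eq_bigr => -[].
apply: eq_bigr => c _; rewrite big_bool /cell_pmf /signb /=.
by case: (e _) => /=; field; rewrite gt_eqF.
Qed.

Definition sample_pmf n e (t : {ffun 'I_n -> C * bool}) : R :=
  \prod_i cell_pmf e (t i).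

Lemma sample_pmf_ge0 n e t : 0 <= @sample_pmf n e t.
Proof. by apply: prodr_ge0 => i _; exact: cell_pmf_ge0. Qed.

(** Stated for arbitrary weights, since it also serves for a sub-probability lying below the
    geometric mean of two laws. *)
Lemma sum_prod_ffun n (s : C * bool -> R) :
  \sum_(t : {ffun 'I_n -> C * bool}) \prod_i s (t i) = (\sum_z s z) ^+ n.
Proof.
by rewrite -(bigA_distr_bigA (fun _ => s)) prodr_const card_ord.
Qed.

Lemma sum_sample_pmf n e : \sum_t @sample_pmf n e t = 1.
Proof. by rewrite sum_prod_ffun sum_cell_pmf expr1n. Qed.

Definition flip b e : {ffun J -> bool} := [ffun j => e j (+) (j == b)].

Lemma flipK b : involutive (flip b).
Proof. by move=> e; apply/ffunP => j; rewrite !ffunE -addbA addbb addbF. Qed.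

Let fiber b := #|[pred c | lab c == b]|.

(** The sum of minima is one minus the total variation distance, which does not tensorize. The
    affinity does, so it is bounded first and then compared with the minima through AM-GM. *)
Lemma flip_affinity n e b : n%:R * delta ^+ 2 * (fiber b)%:R <= #|C|%:R / 4 ->
  1 / 4 <= \sum_t Num.min (@sample_pmf n e t) (sample_pmf (flip b e) t).
Proof.
move=> hn.
(* [s] is below the geometric mean of the two laws: [1 - delta^2] stands for
   [sqrt (1 - delta^2)] on the cells labelled by [b]. *)
pose s z := if lab z.1 == b then (1 - delta ^+ 2) / (2 * #|C|%:R)
            else cell_pmf e z.
have d2 : 0 <= delta ^+ 2 <= 1 by rewrite sqr_ge0 expr_le1.
have s0 z : 0 <= s z.
  rewrite /s; case: ifP => _; last exact: cell_pmf_ge0.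
  by rewrite divr_ge0 ?mulr_ge0 // subr_ge0; case/andP: d2.
(* Every cell has mass [1 / #|C|] under [cell_pmf e]; under [s] only the cells labelled [b] lose
   mass, namely [delta ^+ 2 / #|C|] each. *)
have sE : \sum_z s z = 1 - delta ^+ 2 * (fiber b)%:R / #|C|%:R.
  transitivity (\sum_c \sum_y s (c, y)).
    by rewrite pair_bigA; apply: eq_bigr => -[].
  transitivity (\sum_c (#|C|%:R^-1 -
       if lab c == b then delta ^+ 2 / #|C|%:R else 0)).
    apply: eq_bigr => c _; rewrite big_bool /s /=.
    case: ifP => _; first by field; rewrite gt_eqF.
    by rewrite /cell_pmf /signb /=; case: (e _) => /=; field; rewrite gt_eqF.
  rewrite big_split /= sumr_const -[_^-1 *+ _]mulr_natl mulfV ?gt_eqF //.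
  congr (_ + _).
  rewrite sumrN -big_mkcond /= sumr_const.
  by rewrite -[_ / _ *+ _]mulr_natl mulrCA mulrA.
have fC : (fiber b <= #|C|)%N by exact: max_card.
have hx : 0 <= delta ^+ 2 * (fiber b)%:R / #|C|%:R <= 1.
  rewrite !mulr_ge0 ?sqr_ge0 ?invr_ge0 //= ler_pdivrMr // mul1r.
  rewrite -[leRHS]mul1r ler_pM ?sqr_ge0 ?ler_nat //; by case/andP: d2.
have hs : 3 / 4 <= \sum_(t : {ffun 'I_n -> C * bool}) \prod_i s (t i).
  rewrite sum_prod_ffun sE; apply: le_trans (bernoulli_ineq n hx).
  have : n%:R * (delta ^+ 2 * (fiber b)%:R / #|C|%:R) <= 1 / 4.
    by rewrite !mulrA ler_pdivrMr //; lra.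
  by lra.
(* Away from label [b] the two laws coincide. On label [b] their numerators multiply to
   [1 - delta ^+ 2], which dominates its own square. *)
have sq z : s z ^+ 2 <= cell_pmf e z * cell_pmf (flip b e) z.
  rewrite /s /cell_pmf ffunE; case: ifP => _; last first.
    by rewrite addbF -expr2.
  rewrite mulrACA -invfM expr_div_n -expr2 ler_wpM2r ?invr_ge0 ?sqr_ge0 //.
  rewrite /signb; case: (z.2) => /=; case: (e _) => /=;
  by case/andP: d2; rewrite !expr2; nra.
(* Both sample laws have mass 1, so the total is at least [3 / 4 - (1 + 1) / 4 = 1 / 4]. *)
apply: (@le_trans _ _ (\sum_(t : {ffun 'I_n -> C * bool})
   (\prod_i s (t i) - (sample_pmf e t + sample_pmf (flip b e) t) / 4))).
  rewrite big_split /= sumrN -mulr_suml big_split /= !sum_sample_pmf; lra.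
apply: ler_sum => t _; apply: le_minD_max4; rewrite ?sample_pmf_ge0 //.
rewrite -prodrXl -big_split /=; apply: ler_prod => i _.
by rewrite sqr_ge0 sq.
Qed.

(** The bit vector is drawn uniformly: each cell is then misclassified with mean probability at
    least 1/8, hence so is the mean fraction of wrong cells, and some vector [e] does at least as
    badly as the average. *)
Lemma assouad_reverse_markov n (T : {ffun 'I_n -> C * bool} -> C -> bool) :
  (forall b, n%:R * delta ^+ 2 * (fiber b)%:R <= #|C|%:R / 4) ->
  exists e, 1 / 16 <=
    \sum_(t | (1 / 16 : R) < #|[pred c | T t c != e (lab c)]|%:R / #|C|%:R)
       sample_pmf e t.
Proof.
move=> hn; pose err e t c : R := (T t c != e (lab c))%:R.
have bit c : #|{ffun J -> bool}|%:R / 8 <=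
    \sum_(e : {ffun J -> bool}) \sum_t sample_pmf e t * err e t c.
  set S := \sum_e _; set b := lab c.
  (* The second copy of the sum is reindexed by [flip b]. Whatever value the test takes at [c], it
     is wrong for exactly one of [e] and [flip b e], so the paired errors dominate the minimum of
     the two laws. *)
  suff : \sum_(e : {ffun J -> bool}) (1 / 4) <= S + S.
    by rewrite sumr_const -mulr_natl; lra.
  rewrite [X in _ <= X + _](reindex_inj (inv_inj (flipK b))) /= -big_split /=.
  apply: ler_sum => e _; apply: (le_trans (flip_affinity e (hn b))).
  rewrite -big_split /=; apply: ler_sum => t _.
  rewrite /err ffunE -/b eqxx addbT.
  have := sample_pmf_ge0 e t; have := sample_pmf_ge0 (flip b e) t.
  by case: (T t c); case: (e b) => /= p0 q0;
    rewrite ?mulr0 ?mulr1 ?addr0 ?add0r ge_min lexx ?orbT.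
pose f e t : R := #|[pred c | T t c != e (lab c)]|%:R / #|C|%:R.
have fE e t : f e t = \sum_c err e t c / #|C|%:R.
  rewrite /f /err -mulr_suml -natr_sum; congr (_%:R / _).
  rewrite -sum1_card big_mkcond; apply: eq_bigr => c _.
  by rewrite inE; case: (_ != _).
have avg : #|{ffun J -> bool}|%:R / 8 <=
    \sum_(e : {ffun J -> bool}) \sum_t sample_pmf e t * f e t.
  have -> : \sum_(e : {ffun J -> bool}) \sum_t sample_pmf e t * f e t =
    \sum_c (\sum_(e : {ffun J -> bool}) \sum_t sample_pmf e t * err e t c)
      / #|C|%:R.
    rewrite -mulr_suml [in RHS]exchange_big mulr_suml; apply: eq_bigr => e _.
    rewrite [in RHS]exchange_big mulr_suml; apply: eq_bigr => t _.
    by rewrite fE -!mulr_suml -mulr_sumr mulrA.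
  rewrite -mulr_suml ler_pdivlMr // mulrC.
  rewrite [leLHS]mulr_natl -sumr_const.
  by apply: ler_sum => c _; exact: bit.
(* If every [e] failed, reverse Markov at level 1/16 would give a mean error below [1 / 16 + 1 / 16]
   for each [e], against the average of at least 1/8. *)
apply/existsP; apply: contraT; rewrite negb_exists => /forallP h.
exfalso; suff : \sum_(e : {ffun J -> bool}) \sum_t sample_pmf e t * f e t <
  \sum_(e : {ffun J -> bool}) 1 / 8.
  by rewrite -mulr_suml sumr_const ltNge avg.
apply: ltr_sum => [|e _]; first by apply/hasP; exists [ffun=> true];
  rewrite ?mem_index_enum.
have := h e; rewrite -ltNge => he.
have := reverse_markov (sample_pmf_ge0 e) (sum_sample_pmf n e) (_ : 0 <= 1 / 16)
  (_ : forall t, f e t <= 1).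
move=> /(_ _ _); rewrite -[X in _ -> _ -> _ <= X]/(\sum_(t | 1 / 16 < f e t) _).
have h1 : 0 <= 1 / 16 :> R by lra.
have h2 t : f e t <= 1.
  by rewrite /f ler_pdivrMr // mul1r ler_nat max_card.
move=> /(_ h1 h2) h3; have := le_lt_trans h3 he; lra.
Qed.

End assouad.

(** * Finitely supported probabilities and their sample laws *)

Section atomic_probability.
Context d (T : measurableType d) (R : realType) (I : finType).
Variables (w : I -> R) (pt : I -> T).
Hypotheses (w_ge0 : forall i, 0 <= w i) (sum_w : \sum_i w i = 1).

(** [msum] sums a sequence of measures indexed by [nat], so [I] is enumerated. Indices from [#|I|]
    on receive the zero measure as a default. *)
Let atoms (k : nat) : {measure set T -> \bar R} :=
  if insub k is Some j then
    mscale (NngNum (w_ge0 (enum_val (j : 'I_#|I|)))) \d_(pt (enum_val j))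
  else mzero.

Let atomic : {measure set T -> \bar R} := msum atoms #|I|.

Let atomicE A : atomic A = (\sum_i w i * (pt i \in A)%:R)%:E.
Proof.
rewrite /atomic /= /msum -sumEFin [RHS](reindex _ (onW_bij _ (@enum_val_bij I))) /=.
apply: eq_bigr => k _.
by rewrite /atoms valK /= /mscale /= diracE.
Qed.

Let atomic_setT : atomic setT = 1%E.
Proof.
by rewrite atomicE; congr (_%:E); under eq_bigr do rewrite in_setT mulr1.
Qed.

Definition atomic_prob : probability T R :=
  HB.pack_for (probability T R) (Measure.sort atomic)
    (Measure_isProbability.Build _ _ _ atomic atomic_setT).

Lemma atomic_probE A : atomic_prob A = (\sum_i w i * (pt i \in A)%:R)%:E.
Proof. exact: atomicE. Qed.

Let ge0_integral_atomic D (f : T -> R) :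
  measurable D -> measurable_fun setT f ->
  (forall x, 0 <= f x) ->
  (\int[atomic]_(x in D) (f x)%:E =
   (\sum_i w i * ((pt i \in D)%:R * f (pt i)))%:E)%E.
Proof.
move=> mD mf f0.
have mf' : measurable_fun D (EFin \o f).
  by apply/measurable_EFinP; exact: measurable_funTS.
rewrite ge0_integral_measure_sum //; last by move=> x _; rewrite lee_fin.
rewrite -sumEFin [RHS](reindex _ (onW_bij _ (@enum_val_bij I))) /=.
apply: eq_bigr => k _.
rewrite /atoms valK ge0_integral_mscale //; last by move=> x _; rewrite lee_fin.
by rewrite integral_dirac // diracE.
Qed.

Lemma integral_atomic D (f : T -> R) :
  measurable D -> measurable_fun setT f ->
  (\int[atomic_prob]_(x in D) (f x)%:E =
   (\sum_i w i * ((pt i \in D)%:R * f (pt i)))%:E)%E.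
Proof.
move=> mD mf; rewrite integralE.
under eq_integral do rewrite funeposE -EFin_max.
under [X in (_ - X)%E]eq_integral do rewrite funenegE -EFinN -EFin_max.
rewrite !ge0_integral_atomic //; last 4 first.
- by apply: measurable_maxr => //; exact: measurableT_comp.
- by move=> x; rewrite le_max lexx orbT.
- exact: measurable_maxr.
- by move=> x; rewrite le_max lexx orbT.
rewrite -EFinB -sumrB; congr (_%:E); apply: eq_bigr => i _.
rewrite -!mulrBr; congr (_ * (_ * _)).
have [h|h] := orP (le_total 0 (f (pt i))).
  by rewrite max_l // max_r ?oppr_le0 // subr0.
by rewrite max_r // max_l ?oppr_ge0 // sub0r opprK.
Qed.

Lemma integrable_atomic (f : T -> R) : measurable_fun setT f ->
  atomic_prob.-integrable setT (EFin \o f).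
Proof.
move=> mf; apply/integrableP; split; first exact/measurable_EFinP.
rewrite (_ : (fun x => _) = EFin \o (fun x => `|f x|)) //.
by rewrite integral_atomic ?ltry //; exact: measurableT_comp.
Qed.

End atomic_probability.

Section sample_law_atomic.
Context d (T : measurableType d) (R : realType) (I : finType).
Hypothesis measurable_singleton : forall x : T, measurable [set x].
Variables (P : probability T R) (w : I -> R) (pt : I -> T).
Hypotheses (pt_inj : injective pt) (Pw : forall i, P [set pt i] = (w i)%:E).

(** The samples in [E] composed of the given points form a finite disjoint union of singletons
    inside [E]. This replaces integration over the sample space by a finite sum. *)
Lemma sample_law_ge_atoms n (E : set (n.-tuple T)) : measurable E ->
  ((\sum_(t : {ffun 'I_n -> I} | [tuple pt (t i) | i < n] \in E)
     \prod_i w (t i))%:E <= sample_law P n E)%E.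
Proof.
move=> mE; pose pts (t : {ffun 'I_n -> I}) := [tuple pt (t i) | i < n].
have pts_inj : injective pts.
  move=> t u tu; apply/ffunP => i; apply: pt_inj.
  by move/(congr1 (fun s => tnth s i)) : tu; rewrite !tnth_mktuple.
(* A singleton is written as a rectangle, so that [sample_lawE] evaluates it as a product. *)
have set1E t : [set pts t] = [set s | forall i, [set pt (t i)] (tnth s i)].
  apply/seteqP; split=> s /= => [-> i|h]; first by rewrite tnth_mktuple.
  by apply: eq_from_tnth => i; rewrite tnth_mktuple h.
have mset1 t : measurable [set pts t].
  rewrite set1E (_ : [set _ | _] =
    \bigcap_(i in [set: 'I_n]) ((@tnth _ T ^~ i) @^-1` [set pt (t i)])).
    apply: fin_bigcap_measurable => // i _.
    by rewrite -[X in measurable X]setTI; exact: measurable_tnth.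
  by apply/seteqP; split=> s /= h i => [_|]; exact: h.
pose D := [set t | pts t \in E].
have -> : ((\sum_(t | pts t \in E) \prod_i w (t i))%:E =
    sample_law P n (\bigcup_(t in D) [set pts t]))%E.
  rewrite measure_fin_bigcup //; first last.
  - apply/trivIsetP => t u _ _ /eqP tu; apply/disjoints_subset => _ -> /=.
    by move=> /pts_inj.
  - exact: finite_finset.
  rewrite fsbig_finite //= -sumEFin.
  transitivity (\sum_(t <- [seq t <- index_enum _ | pts t \in E])
      sample_law P n [set pts t])%E.
    rewrite [RHS]big_filter; apply: eq_bigr => t _; 
    rewrite set1E (@sample_lawE _ _ _ P n (fun i => [set pt (t i)])) //.
    by rewrite -prodEFin; apply: eq_bigr => i _; rewrite -Pw.
  apply: perm_big; apply: uniq_perm;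
    rewrite ?filter_uniq ?index_enum_uniq ?fset_uniq //.
  move=> t; rewrite mem_filter mem_index_enum andbT.
  rewrite in_fset_set; last exact: finite_finset.
  by apply/idP/idP => [h|/set_mem //]; exact: mem_set.
apply: le_measure; rewrite ?inE //.
  by apply: fin_bigcup_measurable.
by move=> _ [t Dt ->]; exact/set_mem.
Qed.

End sample_law_atomic.

(** * Borel measurability on the space of matrices *)

Section matrix_measurability.
Context (R : realType) (m n : nat).

Lemma measurable_mx_coord (i : 'I_m) (j : 'I_n) :
  measurable_fun setT (fun A : 'M[R]_(m, n) => A i j).
Proof.
apply: (measurability _ (RGenOpens.measurableE R)) => _ [_ [a [b ->]] <-].
rewrite setTI; apply: sub_sigma_algebra.
by apply: open_comp => [A _|]; [exact: coord_continuous|exact: interval_open].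
Qed.

Lemma measurable_mx_set1 (A : 'M[R]_(m, n)) : measurable [set A].
Proof.
rewrite (_ : [set A] = \bigcap_(i in [set: 'I_m]) \bigcap_(j in [set: 'I_n])
  ((fun B : 'M[R]_(m, n) => B i j) @^-1` [set A i j])).
  apply: fin_bigcap_measurable => // i _.
  apply: fin_bigcap_measurable => // j _.
  by rewrite -[X in measurable X]setTI; exact: measurable_mx_coord.
apply/seteqP; split=> [_ -> i _ j _ //|B /= h].
by apply/matrixP => i j; exact: (h i I j I).
Qed.

Lemma mxdotE (A B : 'M[R]_(m, n)) : mxdot A B = \sum_i \sum_j A i j * B i j.
Proof.
rewrite /mxdot /mxtrace exchange_big /=; apply: eq_bigr => j _; rewrite mxE.
by apply: eq_bigr => i _; rewrite mxE.
Qed.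

Lemma frobenius_sqr (A : 'M[R]_(m, n)) :
  frobenius A ^+ 2 = \sum_i \sum_j A i j ^+ 2.
Proof.
rewrite /frobenius sqr_sqrtr mxdotE //.
by apply: sumr_ge0 => i _; apply: sumr_ge0 => j _; rewrite -expr2 sqr_ge0.
Qed.

Lemma measurable_mxdot (A : 'M[R]_(m, n)) : measurable_fun setT (mxdot A).
Proof.
rewrite (_ : mxdot A = fun B => \sum_i \sum_j A i j * B i j); last first.
  by apply/funext => B; rewrite mxdotE.
apply: measurable_sum => i; apply: measurable_sum => j.
by apply: measurable_funM => //; exact: measurable_mx_coord.
Qed.

Lemma measurable_frobenius_sub (A : 'M[R]_(m, n)) :
  measurable_fun setT (fun B : 'M[R]_(m, n) => frobenius (B - A) ^+ 2).
Proof.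
rewrite (_ : (fun B => _) =
  fun B : 'M[R]_(m, n) => \sum_i \sum_j (B i j - A i j) ^+ 2); last first.
  apply/funext => B; rewrite frobenius_sqr.
  by under eq_bigr do under eq_bigr do rewrite !mxE.
apply: measurable_sum => i; apply: measurable_sum => j.
by apply: measurable_funX; apply: measurable_funB => //;
  exact: measurable_mx_coord.
Qed.

End matrix_measurability.

(** Turns the counts in [uniform_on], taken over sets of matrices, into counts of cells. *)
Lemma card_fset_set_image (T : finType) (U : choiceType) (f : T -> U)
  (Q : pred T) : injective f -> #|` fset_set (f @` [set x | Q x])| = #|Q|.
Proof.
move=> f_inj.
set l := [seq f x | x <- enum Q].
have -> : f @` [set x | Q x] = [set` seq_fset tt l].
  apply/seteqP; split=> y.
    move=> [x Qx <-]; change (f x \in seq_fset tt l).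
    by rewrite seq_fsetE map_f // mem_enum.
  change (y \in seq_fset tt l -> (f @` [set x | Q x]) y).
  by rewrite seq_fsetE => /mapP[x]; rewrite mem_enum => Qx ->; exists x.
rewrite set_fsetK size_seq_fset undup_id ?size_map -?cardE //.
by rewrite map_inj_uniq ?enum_uniq.
Qed.

(** * The two-point regression laws and the loss of an estimator *)

Section two_point_class.
Variables (R : realType) (m1 m2 : nat) (J : finType).
Variables (lab : 'I_m1 * 'I_m2 -> J) (eta delta : R).
Hypotheses (eta_gt0 : 0 < eta) (delta_gt0 : 0 < delta) (delta_le1 : delta <= 1).
Hypothesis C_gt0 : (0 < #|{: 'I_m1 * 'I_m2}|)%N.
Implicit Types (e : {ffun J -> bool}) (c : 'I_m1 * 'I_m2).

Definition sign_mx e : 'M[R]_(m1, m2) :=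
  \matrix_(i, j) (eta * delta * signb R (e (lab (i, j)))).

Definition design c : 'M[R]_(m1, m2) := delta_mx c.1 c.2.

Definition sample_pt (z : 'I_m1 * 'I_m2 * bool) : 'M[R]_(m1, m2) * R :=
  (design z.1, eta * signb R z.2).

Lemma design_inj : injective design.
Proof.
move=> [i j] [k l] /matrixP /(_ i j); rewrite !mxE !eqxx /=.
case: eqP => [->|_]; last by move/eqP; rewrite oner_eq0.
by case: eqP => [->//|_]; move/eqP; rewrite oner_eq0.
Qed.

Lemma signb_inj : injective (signb R).
Proof. by move=> [] []; rewrite /signb //; lra. Qed.

Lemma sample_pt_inj : injective sample_pt.
Proof.
move=> [c y] [c' y'] [/design_inj -> /(mulfI (lt0r_neq0 eta_gt0))].
by move/signb_inj ->.
Qed.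

Lemma designsE : @designs R m1 m2 = range design.
Proof.
have dE c : design c = evec R c.1 *m (evec R c.2)^T.
  by rewrite /evec trmx_delta mul_delta_mx.
apply/seteqP; split=> X /=.
  by move=> [i [j ->]]; exists (i, j); rewrite // dE.
by move=> [c _ <-]; exists c.1, c.2; exact: dE.
Qed.

Lemma mxdot_design A c : mxdot A (design c) = A c.1 c.2.
Proof.
rewrite mxdotE (bigD1 c.1) //= (bigD1 c.2) //= !big1 ?addr0 => [|i ic|j jc].
- by rewrite mxE !eqxx mulr1.
- by apply: big1 => j _; rewrite mxE (negbTE ic) mulr0.
- by rewrite mxE (negbTE jc) andbF mulr0.
Qed.

Definition sign_law e : probability ('M[R]_(m1, m2) * R)%type R :=
  @atomic_prob _ _ R ('I_m1 * 'I_m2 * bool)%type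
    (cell_pmf lab delta e) sample_pt
    (cell_pmf_ge0 lab (ltW delta_gt0) delta_le1 e)
    (sum_cell_pmf lab delta C_gt0 e).

Lemma sign_law_pt e z :
  sign_law e [set sample_pt z] = (cell_pmf lab delta e z)%:E.
Proof.
rewrite atomic_probE (bigD1 z) //= big1 ?addr0 => [|z' zz'].
  by rewrite mem_set // mulr1.
rewrite memNset ?mulr0 // => /sample_pt_inj zz.
by rewrite zz eqxx in zz'.
Qed.

Lemma sum_sample_pt (F : 'I_m1 * 'I_m2 * bool -> R) :
  \sum_z F z = \sum_c (F (c, true) + F (c, false)).
Proof.
transitivity (\sum_c \sum_y F (c, y)).
  by rewrite pair_bigA; apply: eq_bigr => -[].
by apply: eq_bigr => c _; rewrite big_bool.
Qed.

(** The response takes only the extreme values [eta] and [- eta]. Its mean on a cell is [eta * ((1 +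
    delta) / 2 - (1 - delta) / 2) = eta * delta] up to the sign of the bit, which is the entry of
    [sign_mx e]. *)
Lemma sign_law_class e : mx_class (sign_mx e) eta (sign_law e).
Proof.
have C0 : #|{: 'I_m1 * 'I_m2}|%:R != 0 :> R by rewrite pnatr_eq0 -lt0n.
split.
- move=> B mB; rewrite atomic_probE sum_sample_pt; congr (_%:E).
  rewrite /uniform_on designsE.
  have -> : range design `&` B = design @` [set c | design c \in B].
    apply/seteqP; split=> X /=.
      by move=> [[c _ <-] Bc]; exists c => //; exact: mem_set.
    by move=> [c /set_mem Bc <-]; split => //; exists c.
  have -> : range design = design @` [set c | predT c].
    by apply/seteqP; split=> _ [c _ <-]; exists c.
  rewrite !(card_fset_set_image _ design_inj).
  rewrite -sum1_card natr_sum mulr_suml [RHS]big_mkcond /=.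
  apply: eq_bigr => c _.
  have hy y : (sample_pt (c, y) \in fst @^-1` B) = (design c \in B).
    by apply/idP/idP => /set_mem h; exact/mem_set.
  rewrite !hy unfold_in /=; case: ifP => _; last by rewrite !mulr0 addr0.
  rewrite /cell_pmf /signb /=; by case: (e _) => /=; field.
(* This set is null because every atom has response exactly [eta] in absolute value. *)
- exists [set z | eta < `|z.2|]; split.
  + rewrite -[X in measurable X]setTI.
    apply: (measurable_fun_ltr (f := cst eta)
      (g := fun z : 'M[R]_(m1, m2) * R => `|z.2|)) => //.
    by apply: measurableT_comp => //; exact: measurable_snd.
  + rewrite atomic_probE big1 // => z _; rewrite memNset ?mulr0 //=.
    rewrite normrM (gtr0_norm eta_gt0) /signb.
    by case: z.2; rewrite ?normrN1 ?normr1 mulr1 ltxx.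
  + by move=> z /= /negP; rewrite -ltNge.
- split.
  + by apply: integrable_atomic; exact: measurable_snd.
  + exact: measurable_mxdot.
  + apply: integrable_atomic.
    exact: measurableT_comp (measurable_mxdot (sign_mx e)) measurable_fst.
  + move=> B mB.
    have mXB : measurable (fst @^-1` B : set ('M[R]_(m1, m2) * R)).
      by rewrite -[X in measurable X]setTI; exact: measurable_fst.
    rewrite !integral_atomic //; last first.
      exact: measurableT_comp (measurable_mxdot (sign_mx e)) measurable_fst.
    (* The two integrals agree cell by cell once the two signs are added up. *)
    congr (_%:E); rewrite !sum_sample_pt; apply: eq_bigr => c _.
    have hy y : (sample_pt (c, y) \in fst @^-1` B) = (design c \in B).
      by apply/idP/idP => /set_mem h; exact/mem_set.
    rewrite !hy /sample_pt /= mxdot_design mxE -surjective_pairing.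
    rewrite /cell_pmf /signb /=; by case: (e _) => /=; field.
Qed.

(** The signs of the estimator's entries are a test of the bits. More than a fraction 1/16 of wrong
    signs forces the normalized loss above [(eta * delta) ^+ 2 / 16]. *)
Lemma sign_estimation n
  (Ahat : n.-tuple ('M[R]_(m1, m2) * R)%type -> 'M[R]_(m1, m2)) :
  measurable_fun setT Ahat ->
  (forall b,
    n%:R * delta ^+ 2 * #|[pred c | lab c == b]|%:R <= (m1 * m2)%:R / 4) ->
  exists e, ((1 / 16)%:E <= sample_law (sign_law e) n
    [set s | ((eta * delta) ^+ 2 / 16 <
              (m1 * m2)%:R^-1 * frobenius (Ahat s - sign_mx e) ^+ 2)%R])%E.
Proof.
move=> mAhat.
have CE : #|{: 'I_m1 * 'I_m2}| = (m1 * m2)%N by rewrite card_prod !card_ord.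
rewrite -CE => hfib.
pose pts (t : {ffun 'I_n -> 'I_m1 * 'I_m2 * bool}) :=
  [tuple sample_pt (t i) | i < n].
(* A zero entry counts as a negative sign. *)
have [e he] := assouad_reverse_markov (ltW delta_gt0) delta_le1 C_gt0
  (fun t c => 0 < Ahat (pts t) c.1 c.2) hfib.
exists e; set E := [set s | _].
have mE : measurable E.
  rewrite -[X in measurable X]setTI.
  apply: (measurable_fun_ltr (f := cst _)) => //.
  apply: measurable_funM => //.
  exact: (measurableT_comp (measurable_frobenius_sub (sign_mx e))).
apply: le_trans
  (sample_law_ge_atoms _ sample_pt_inj (sign_law_pt e) mE); last first.
  move=> z; rewrite (_ : [set z] = fst @^-1` [set z.1] `&` snd @^-1` [set z.2]).
    apply: measurableI.
      rewrite -[X in measurable X]setTI; apply: measurable_fst => //.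
      exact: measurable_mx_set1.
    by rewrite -[X in measurable X]setTI; apply: measurable_snd.
  by apply/seteqP; split=> [_ ->//|[a b] /= [-> ->]]; case: z.
rewrite lee_fin; apply: (le_trans he).
(* It remains to see that every sample with too many wrong signs lies in [E]. *)
rewrite big_mkcond [leRHS]big_mkcond /=; apply: ler_sum => t _.
case: ifP => [ht|_]; last first.
  by case: ifP => // _; apply: (sample_pmf_ge0 lab (ltW delta_gt0)).
rewrite ifT //; apply: mem_set; rewrite /E /= -/(pts t).
rewrite frobenius_sqr [_^-1 * _]mulrC.
have CR : 0 < #|{: 'I_m1 * 'I_m2}|%:R :> R by rewrite ltr0n.
move: ht; rewrite ltr_pdivlMr // => ht; rewrite ltr_pdivlMr //.
apply: (@lt_le_trans _ _ ((eta * delta) ^+ 2 *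
   #|[pred c | (0 < Ahat (pts t) c.1 c.2) != e (lab c)]|%:R)).
  have g0 : 0 < (eta * delta) ^+ 2.
    by rewrite exprn_gt0 // mulr_gt0.
  by rewrite -(ltr_pM2l g0) in ht; lra.
rewrite pair_bigA /= -sum1_card natr_sum mulr_sumr big_mkcond.
apply: ler_sum => c _; rewrite inE.
case: ifP => [hc|_]; last exact: sqr_ge0.
rewrite mulr1 !mxE -surjective_pairing.
have g0 : 0 <= eta * delta by rewrite mulr_ge0 // ltW.
(* With a wrong sign, zero separates the estimate (weakly) from the true entry, which is at distance
   [eta * delta] from zero. *)
move: hc; rewrite /signb; case: (e _); case: ltP => //= hA _;
  rewrite !expr2; nra.
Qed.

End two_point_class.

(** * Periodic labellings: fibre sizes and rank *)

(** A residue class has at most [m %/ r + 1] members below [m], and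
    [(m %/ r + 1) * r <= m + r <= 2 * m]. The factor 2 pays for [r] not dividing [m]. *)
Lemma card_modn_fiber (m r : nat) (r_gt0 : (0 < r)%N) (l : 'I_r) : (r <= m)%N ->
  (#|[pred k : 'I_m | Ordinal (ltn_pmod k r_gt0) == l]| * r <= 2 * m)%N.
Proof.
move=> rm; set A := [pred k | _].
have cA : (#|A| <= (m %/ r).+1)%N.
  (* Within a residue class, [k] is determined by its quotient by [r]. *)
  rewrite -[leqRHS]card_ord.
  apply: (@leq_card_in _ _ (fun k : 'I_m => inord (k %/ r) : 'I_(m %/ r).+1)).
  have bd (k : 'I_m) : (k %/ r < (m %/ r).+1)%N.
    by rewrite ltnS; apply: leq_div2r; exact: ltnW (ltn_ord k).
  move=> k k'; rewrite !inE => /eqP <- /eqP [kk'] /(congr1 val) /=.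
  rewrite (inordK (bd k)) (inordK (bd k')) => dd.
  by apply: val_inj => /=; rewrite (divn_eq k r) (divn_eq k' r) dd kk'.
apply: (leq_trans (leq_mul cA (leqnn r))).
by rewrite mulSn mul2n -addnn leq_add // leq_trunc_div.
Qed.

(** Column [k] repeats column [k %% r] of an [m1] by [r] matrix, so the sign matrix factors through
    dimension [r] by a 0-1 selection matrix. *)
Lemma sign_mx_rank_rows (R : realType) (m1 m2 r : nat) (r_gt0 : (0 < r)%N)
    (eta delta : R) (e : {ffun 'I_m1 * 'I_r -> bool}) :
  (\rank (sign_mx (fun c : 'I_m1 * 'I_m2 => (c.1, Ordinal (ltn_pmod c.2 r_gt0)))
     eta delta e) <= r)%N.
Proof.
set A := sign_mx _ _ _ _.
pose U : 'M[R]_(m1, r) := \matrix_(i, l) (eta * delta * signb R (e (i, l))).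
pose S : 'M[R]_(r, m2) := \matrix_(l, k) (l == Ordinal (ltn_pmod k r_gt0))%:R.
have -> : A = U *m S.
  apply/matrixP => i k; rewrite !mxE (bigD1 (Ordinal (ltn_pmod k r_gt0))) //=.
  rewrite big1 ?addr0 => [|l hl]; last by rewrite !mxE (negbTE hl) mulr0.
  by rewrite !mxE eqxx mulr1.
exact: mulmx_max_rank.
Qed.

Lemma sign_mx_rank_cols (R : realType) (m1 m2 r : nat) (r_gt0 : (0 < r)%N)
    (eta delta : R) (e : {ffun 'I_r * 'I_m2 -> bool}) :
  (\rank (sign_mx (fun c : 'I_m1 * 'I_m2 => (Ordinal (ltn_pmod c.1 r_gt0), c.2))
     eta delta e) <= r)%N.
Proof.
set A := sign_mx _ _ _ _.
pose S : 'M[R]_(m1, r) := \matrix_(k, l) (l == Ordinal (ltn_pmod k r_gt0))%:R.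
pose U : 'M[R]_(r, m2) := \matrix_(l, j) (eta * delta * signb R (e (l, j))).
have -> : A = S *m U.
  apply/matrixP => k j; rewrite !mxE (bigD1 (Ordinal (ltn_pmod k r_gt0))) //=.
  rewrite big1 ?addr0 => [|l hl]; last by rewrite !mxE (negbTE hl) mul0r.
  by rewrite !mxE eqxx mul1r.
exact: mulmx_max_rank.
Qed.

(** Reducing the index of the shorter side modulo [r] leaves the longer index free, which gives
    [maxn m1 m2 * r] labels, as many as the target rate requires. *)
Lemma low_rank_labelling (R : realType) (m1 m2 r : nat) :
  (1 <= r <= minn m1 m2)%N ->
  exists (J : finType) (lab : 'I_m1 * 'I_m2 -> J),
    (forall (eta delta : R) e, (\rank (sign_mx lab eta delta e) <= r)%N) /\
    (forall b, #|[pred c | lab c == b]| * (maxn m1 m2 * r) <= 2 * (m1 * m2))%N.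
Proof.
rewrite leq_min => /and3P[r_gt0 r1 r2].
have [m12|m21] := leqP m1 m2.
  exists ('I_r * 'I_m2)%type,
    (fun c : 'I_m1 * 'I_m2 => (Ordinal (ltn_pmod c.1 r_gt0), c.2)).
  split=> [eta delta e|[l j]]; first exact: sign_mx_rank_cols.
  have -> : #|[pred c : 'I_m1 * 'I_m2 |
      (Ordinal (ltn_pmod c.1 r_gt0), c.2) == (l, j)]|
     = #|[pred k : 'I_m1 | Ordinal (ltn_pmod k r_gt0) == l]|.
    rewrite -[RHS]muln1 -(card1 j) -cardX; apply: eq_card => c.
    by rewrite !inE xpair_eqE.
  by rewrite mulnCA mulnC mulnA leq_mul2r card_modn_fiber // orbT.
exists ('I_m1 * 'I_r)%type,
  (fun c : 'I_m1 * 'I_m2 => (c.1, Ordinal (ltn_pmod c.2 r_gt0))).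
split=> [eta delta e|[i l]]; first exact: sign_mx_rank_rows.
have -> : #|[pred c : 'I_m1 * 'I_m2 |
    (c.1, Ordinal (ltn_pmod c.2 r_gt0)) == (i, l)]|
   = #|[pred k : 'I_m2 | Ordinal (ltn_pmod k r_gt0) == l]|.
  rewrite -[RHS]mul1n -(card1 i) -cardX; apply: eq_card => c.
  by rewrite !inE xpair_eqE.
by rewrite mulnCA [leqRHS]mulnCA leq_mul2l card_modn_fiber // orbT.
Qed.

(** * Calibration of the separation and the minimax bound *)

Theorem theorem7 (R : realType) :
  exists beta c : R, [/\ 0 < beta, beta < 1, 0 < c &
    forall (m1 m2 n r : nat) (eta : R),
      0 < eta -> (1 <= r <= minn m1 m2)%N -> (maxn m1 m2 * r <= n)%N ->
      (beta%:E <=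
       ereal_inf
         [set ereal_sup
           [set ereal_sup
             [set sample_law P n
               [set s | (c * eta ^+ 2 * ((maxn m1 m2 * r)%:R / n%:R) <
                         (m1 * m2)%:R^-1 * frobenius (Ahat s - A0) ^+ 2)%R]
             | P in mx_class A0 eta]
           | A0 in [set A : 'M[R]_(m1, m2) | (\rank A <= r)%N]]
         | Ahat in @estimators R m1 m2 n])%E].
Proof.
(* [beta] is the probability from Assouad's argument; 1/256 is the wrong fraction 1/16 times the
   1/16 in [delta ^+ 2]. *)
exists (1 / 16), (1 / 256); split; [by lra|by lra|by lra|].
move=> m1 m2 n r eta eta_gt0 hr hn.
have [J [lab [lab_rank lab_fiber]]] := low_rank_labelling R hr.
move: hr; rewrite leq_min => /and3P[r_gt0 r1 r2].
have C_gt0 : (0 < #|{: 'I_m1 * 'I_m2}|)%N.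
  by rewrite card_prod !card_ord muln_gt0 !(leq_trans r_gt0).
set N := (maxn m1 m2 * r)%N in hn lab_fiber *.
have N_gt0 : (0 < N)%N.
  by rewrite muln_gt0 r_gt0 andbT (leq_trans r_gt0) // leq_max r1.
have n_gt0 : 0 < n%:R :> R by rewrite ltr0n (leq_trans N_gt0).
have NR_gt0 : 0 < N%:R :> R by rewrite ltr0n.
(* This makes [n * delta ^+ 2] equal to [N / 16], so the fibre bound [2 * (m1 * m2) / N] yields
   [(m1 * m2) / 8], within the allowed quarter. That [delta <= 1] comes from [N <= n]. *)
pose delta : R := Num.sqrt (N%:R / n%:R) / 4.
have delta2 : delta ^+ 2 = N%:R / n%:R / 16.
  by rewrite /delta expr_div_n sqr_sqrtr ?divr_ge0 //; congr (_ / _); ring.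
have delta_gt0 : 0 < delta by rewrite divr_gt0 // sqrtr_gt0 divr_gt0.
have delta_le1 : delta <= 1.
  rewrite -(@ler_pXn2r _ 2) ?nnegrE ?ltW // delta2 expr1n.
  have : N%:R / n%:R <= 1 :> R by rewrite ler_pdivrMr // mul1r ler_nat.
  by lra.
have hfib b :
    n%:R * delta ^+ 2 * #|[pred c | lab c == b]|%:R <= (m1 * m2)%:R / 4.
  have : (#|[pred c | lab c == b]| * N)%:R <= (2 * (m1 * m2))%:R :> R.
    by rewrite ler_nat.
  rewrite delta2 natrM (natrM _ 2) => h.
  rewrite (_ : n%:R * _ * _ = #|[pred c | lab c == b]|%:R * N%:R / 16);
    last first.
    by field; rewrite gt_eqF.
  have : 0 <= (m1 * m2)%:R :> R by [].
  by lra.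
apply: le_ereal_inf_tmp => _ [Ahat mAhat <-].
(* The hard vector [e] depends on the estimator, as the order of infimum and suprema allows. *)
have [e he] := sign_estimation eta_gt0 delta_gt0 delta_le1 C_gt0 mAhat hfib.
apply: (le_trans he).
apply: le_ereal_sup_tmp; eexists.
  by exists (sign_mx lab eta delta e); [exact: lab_rank|reflexivity].
apply: ereal_sup_ubound; exists (sign_law lab eta delta_gt0 delta_le1 C_gt0 e).
  exact: sign_law_class.
rewrite (_ : (eta * delta) ^+ 2 / 16 = 1 / 256 * eta ^+ 2 * (N%:R / n%:R)) //.
rewrite exprMn delta2; field; lra.
Qed.
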